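(* For any diagonal section $\delta$ with $\delta\ne\delta_M$ (where $\delta_M(x)=x$ for all $x\in[0,1]$), $$\mu_\delta=\max\{\widehat{\delta}(x): x\in[0,1],\ (x,g^\delta_U(x))\in H_\delta,\ g^\delta_U(x)>x\}.$$
   Context: $\mathbb{I}=[0,1]$. A (bivariate) copula is a function $C\colon\mathbb{I}^2\to\mathbb{I}$ with $C(x,0)=C(0,y)=0$, $C(x,1)=x$, $C(1,y)=y$, and $C(b,d)+C(a,c)-C(b,c)-C(a,d)\ge 0$ for all $a\le b$, $c\le d$. A diagonal section is $\delta\colon\mathbb{I}\to\mathbb{I}$ with $\delta(x)\le x$, $0\le\delta(y)-\delta(x)\le 2(y-x)$ for $x\le y$, $\delta(1)=1$; $\widehat{\delta}(x)=x-\delta(x)$. The asymmetry of a copula is $\mu(C)=\max_{x,y}|C(x,y)-C(y,x)|$ and $\mu_\delta=\sup\{\mu(C): C\text{ copula with } C(t,t)=\delta(t)\ \forall t\}$. For $x\le y$ let $\mathrm{TV}_x^y(\widehat{\delta})$ be the total variation of $\widehat{\delta}$ on $[x,y]$, and $\mathrm{TV}_x^y=-\mathrm{TV}_y^x$ for $y<x$. Let $f^\delta(x,y)=y-\frac12(\widehat{\delta}(x)+\widehat{\delta}(y)+\mathrm{TV}_x^y(\widehat{\delta}))$, $D_f^\circ(\delta)=\{(x,y)\in\mathbb{I}^2: f^\delta(x,y)<\min\{x,y\}\}$, $D_f(\delta)=\overline{D_f^\circ(\delta)}\cup\{(x,x):x\in\mathbb{I}\}$, $g^\delta_U(x)=\max\{y:(x,y)\in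 D_f(\delta)\}$. Define $h^\delta(x)=\max\{y\in\mathbb{I}: y\ge x,\ \widehat{\delta}(t)\ge\widehat{\delta}(x)\ \text{for all } t\in[x,y]\}$, let $Z_\delta$ be the set of discontinuity points of $h^\delta$, and $H_\delta=\{(x,h^\delta(x)):x\in\mathbb{I}\}\cup\bigcup_{x\in Z_\delta}\big(\{x\}\times[\liminf_{t\to x}h^\delta(t),h^\delta(x)]\big)$. *)

(* Defs.v *)
From Stdlib Require Import Reals Lra.
From Coquelicot Require Import Coquelicot.
Open Scope R_scope.

Definition InI (x : R) : Prop := 0 <= x <= 1.

Definition is_max (P : R -> Prop) (m : R) : Prop :=
  P m /\ forall y, P y -> y <= m.

Definition copula (C : R -> R -> R) : Prop :=
  (forall x y, InI x -> InI y -> InI (C x y)) /\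
  (forall x, InI x -> C x 0 = 0 /\ C 0 x = 0 /\ C x 1 = x /\ C 1 x = x) /\
  (forall a b c d, InI a -> InI b -> InI c -> InI d -> a <= b -> c <= d ->
     C b d + C a c - C b c - C a d >= 0).

Definition diagonal_section (delta : R -> R) : Prop :=
  (forall x, InI x -> InI (delta x)) /\
  (forall x, InI x -> delta x <= x) /\
  (forall x y, InI x -> InI y -> x <= y ->
     0 <= delta y - delta x /\ delta y - delta x <= 2 * (y - x)) /\
  delta 1 = 1.

Definition dhat (delta : R -> R) (x : R) : R := x - delta x.

(* Asymmetry mu(C) = max_{x,y in I} |C(x,y) - C(y,x)| (taken as a sup; it is attained). *)
Definition mu (C : R -> R -> R) : R :=
  real (Lub_Rbar (fun v => exists x y, InI x /\ InI y /\ v = Rabs (C x y - C y x))).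

Definition mu_delta (delta : R -> R) : R :=
  real (Lub_Rbar (fun v => exists C, copula C /\ (forall t, InI t -> C t t = delta t)
                                    /\ v = mu C)).

Fixpoint psum (g : nat -> R) (n : nat) : R :=
  match n with
  | O => 0
  | S k => psum g k + g k
  end.

Definition partition (a b : R) (t : nat -> R) (n : nat) : Prop :=
  t O = a /\ t n = b /\ (forall i, (i < n)%nat -> t i <= t (S i)).

Definition TV (f : R -> R) (a b : R) : R :=
  real (Lub_Rbar (fun s => exists t n, partition a b t n /\
          s = psum (fun i => Rabs (f (t (S i)) - f (t i))) n)).

Definition TVs (f : R -> R) (x y : R) : R :=
  if Rle_dec x y then TV f x y else - TV f y x.

Definition fdelta (delta : R -> R) (x y : R) : R :=
  y - / 2 * (dhat delta x + dhat delta y + TVs (dhat delta) x y).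

Definition Dfo (delta : R -> R) (x y : R) : Prop :=
  InI x /\ InI y /\ fdelta delta x y < Rmin x y.

Definition Df (delta : R -> R) (x y : R) : Prop :=
  (forall eps, 0 < eps -> exists a b, Dfo delta a b /\ Rabs (a - x) < eps /\ Rabs (b - y) < eps)
  \/ (InI x /\ y = x).

(* g_U^delta(x) = max { y : (x,y) in D_f(delta) } (taken as sup; it is attained). *)
Definition gU (delta : R -> R) (x : R) : R :=
  real (Lub_Rbar (fun y => Df delta x y)).

(* h^delta(x) = max { y in I : y >= x, dhat(t) >= dhat(x) for t in [x,y] } (as sup; attained). *)
Definition hdelta (delta : R -> R) (x : R) : R :=
  real (Lub_Rbar (fun y => InI y /\ x <= y /\
          forall t, x <= t <= y -> dhat delta t >= dhat delta x)).

Definition Zdelta (delta : R -> R) (x : R) : Prop :=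
  InI x /\ ~ (forall eps, 0 < eps -> exists d, 0 < d /\
      forall t, InI t -> Rabs (t - x) < d ->
        Rabs (hdelta delta t - hdelta delta x) < eps).

Definition liminf_h (delta : R -> R) (x : R) : R :=
  real (Lub_Rbar (fun r => exists eps, 0 < eps /\
     r = real (Glb_Rbar (fun v => exists t, InI t /\ 0 < Rabs (t - x) < eps
                                        /\ v = hdelta delta t)))).

Definition Hdelta (delta : R -> R) (x y : R) : Prop :=
  InI x /\
  (y = hdelta delta x \/
   (Zdelta delta x /\ liminf_h delta x <= y /\ y <= hdelta delta x)).

(* Main.v *)
(* Put d = dhat delta, p(x) = x - (d(x) + TV_0^x d)/2 and q(x) = x + (d(x) - TV_0^x d)/2. Both are
   nondecreasing and 1-Lipschitz, q - p = d, and fdelta(x,y) = x + p(y) - q(x) for x <= y. A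
   copula C with diagonal delta satisfies, for x <= y, C(x,y) <= min(x, fdelta(x,y)) and
   C(y,x) >= x - min_{[x,y]} d. Gluing these two bounds along the diagonal is again a copula, so
   mu_delta is the maximum of min_{[x,y]} d - max(0, q(x) - p(y)) over x <= y. Moving y to the
   right until p(y) = q(x) does not decrease this, so mu_delta is the largest M such that d >= M on
   some [x,y] with q(x) <= p(y). Enlarge that interval to a component [a,b] of {d >= M} and then
   move a to the right as far as d(a) = M and q(a) <= p(b) permit: gU(a) <= b = h(a), and if
   gU(a) < b, maximality of M forces h(s) to be at most about gU(a) for s slightly above a, so the
   point (a, gU(a)) lies on the vertical segment of H at a. *)

Require Import Defs.
From Stdlib Require Import Reals Lra Lia Arith Classical.
From Coquelicot Require Import Coquelicot.
Open Scope R_scope.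

(** * Suprema and infima of bounded sets, and Lipschitz conditions on the unit interval *)

(** The element [x0] and the bound [B] exclude the infinite values of [Lub_Rbar], which [real] would
    send to 0. *)
Lemma real_Lub_correct (E : R -> Prop) (x0 B : R) :
  E x0 -> (forall x, E x -> x <= B) -> is_lub E (real (Lub_Rbar E)).
Proof.
  intros H0 HB.
  destruct (Lub_Rbar_correct E) as [Hub Hleast].
  assert (HleB : Rbar_le (Lub_Rbar E) B) by (apply Hleast; intros x Hx; exact (HB x Hx)).
  pose proof (Hub x0 H0) as H0le.
  destruct (Lub_Rbar E) as [l | |]; simpl in *; try contradiction.
  split.
  - intros x Hx; exact (Hub x Hx).
  - intros b Hb; apply (Hleast (Finite b)); intros x Hx; exact (Hb x Hx).
Qed.

Definition is_glb (E : R -> Prop) (m : R) : Prop :=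
  (forall x, E x -> m <= x) /\ (forall b, (forall x, E x -> b <= x) -> b <= m).

Lemma real_Glb_correct (E : R -> Prop) (x0 B : R) :
  E x0 -> (forall x, E x -> B <= x) -> is_glb E (real (Glb_Rbar E)).
Proof.
  intros H0 HB.
  destruct (Glb_Rbar_correct E) as [Hlb Hgreatest].
  assert (HleB : Rbar_le B (Glb_Rbar E)) by (apply Hgreatest; intros x Hx; exact (HB x Hx)).
  pose proof (Hlb x0 H0) as H0le.
  destruct (Glb_Rbar E) as [l | |]; simpl in *; try contradiction.
  split.
  - intros x Hx; exact (Hlb x Hx).
  - intros b Hb; apply (Hgreatest (Finite b)); intros x Hx; exact (Hb x Hx).
Qed.

Lemma is_lub_approx (E : R -> Prop) (s r : R) :
  is_lub E s -> r < s -> exists x, E x /\ r < x.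
Proof.
  intros [_ Hleast] Hr. apply NNPP; intro Hno.
  enough (s <= r) by lra.
  apply Hleast; intros x Hx. destruct (Rle_or_lt x r); [assumption |].
  exfalso; apply Hno; now exists x.
Qed.

Lemma le_of_forall_eps (a b : R) : (forall eps, 0 < eps -> a <= b + eps) -> a <= b.
Proof.
  intros H. destruct (Rle_or_lt a b); [assumption |].
  specialize (H ((a - b) / 2)); lra.
Qed.

Lemma InI_0 : InI 0.
Proof. unfold InI; lra. Qed.

Lemma InI_1 : InI 1.
Proof. unfold InI; lra. Qed.

Definition lip1 (f : R -> R) : Prop :=
  forall x y, InI x -> InI y -> x <= y -> Rabs (f y - f x) <= y - x.

Definition mono_lip1 (f : R -> R) : Prop :=
  forall x y, InI x -> InI y -> x <= y -> 0 <= f y - f x <= y - x.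

Lemma lip1_bounds (f : R -> R) (x y : R) :
  lip1 f -> InI x -> InI y -> x <= y -> x - y <= f y - f x <= y - x.
Proof.
  intros Hf Hx Hy Hxy. pose proof (Hf x y Hx Hy Hxy) as H.
  apply Rabs_le_between in H. lra.
Qed.

(** * Total variation *)

Lemma psum_le (g h : nat -> R) (n : nat) :
  (forall i, (i < n)%nat -> g i <= h i) -> psum g n <= psum h n.
Proof.
  induction n as [| n IH]; intros H; simpl; [lra |].
  pose proof (H n (Nat.lt_succ_diag_r n)).
  assert (psum g n <= psum h n) by (apply IH; intros; apply H; lia). lra.
Qed.

Lemma psum_plus (g h : nat -> R) (n : nat) :
  psum (fun i => g i + h i) n = psum g n + psum h n.
Proof. induction n as [| n IH]; simpl; lra. Qed.

Lemma psum_ext (g h : nat -> R) (n : nat) :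
  (forall i, (i < n)%nat -> g i = h i) -> psum g n = psum h n.
Proof.
  intros H; apply Rle_antisym; apply psum_le; intros i Hi; rewrite H by assumption; lra.
Qed.

Lemma psum_cat (g : nat -> R) (n m : nat) :
  psum g (n + m) = psum g n + psum (fun i => g (n + i)%nat) m.
Proof.
  induction m as [| m IH]; simpl.
  - rewrite Nat.add_0_r; lra.
  - rewrite Nat.add_succ_r; simpl; rewrite IH; lra.
Qed.

Lemma partition_le (a b : R) (t : nat -> R) (n i j : nat) :
  partition a b t n -> (i <= j)%nat -> (j <= n)%nat -> t i <= t j.
Proof.
  intros (_ & _ & Hm) Hij Hj. induction Hij as [| j Hij IH]; [lra |].
  assert (t i <= t j) by (apply IH; lia).
  assert (t j <= t (S j)) by (apply Hm; lia). lra.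
Qed.

Lemma partition_in (a b : R) (t : nat -> R) (n i : nat) :
  partition a b t n -> (i <= n)%nat -> a <= t i <= b.
Proof.
  intros Hp Hi. pose proof Hp as (H0 & Hn & _).
  rewrite <- H0, <- Hn. split; eapply partition_le; eauto; lia.
Qed.

Definition variation (f : R -> R) (t : nat -> R) (n : nat) : R :=
  psum (fun i => Rabs (f (t (S i)) - f (t i))) n.

Lemma variation_le (f : R -> R) (a b : R) (t : nat -> R) (n : nat) :
  lip1 f -> InI a -> InI b -> partition a b t n -> variation f t n <= b - a.
Proof.
  intros Hf Ha Hb Hp.
  assert (H : forall k, (k <= n)%nat -> variation f t k <= t k - t 0%nat).
  { induction k as [| k IH]; intros Hk; unfold variation; simpl; [lra |].
    specialize (IH ltac:(lia)); unfold variation in IH.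
    pose proof (partition_in _ _ _ _ k Hp ltac:(lia)).
    pose proof (partition_in _ _ _ _ (S k) Hp ltac:(lia)).
    pose proof (partition_le _ _ _ _ k (S k) Hp ltac:(lia) ltac:(lia)).
    unfold InI in *.
    pose proof (Hf (t k) (t (S k)) ltac:(unfold InI; lra) ltac:(unfold InI; lra) ltac:(lra)).
    lra. }
  specialize (H n (Nat.le_refl n)). destruct Hp as (H0 & Hn & _).
  rewrite H0, Hn in H. exact H.
Qed.

Lemma variation_chord (f : R -> R) (a b : R) :
  a <= b -> exists t n, partition a b t n /\ variation f t n = Rabs (f b - f a).
Proof.
  intros Hab. exists (fun i => match i with O => a | _ => b end), 1%nat. split.
  - repeat split. intros i Hi. replace i with 0%nat by lia. exact Hab.
  - unfold variation; simpl; lra.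
Qed.

Lemma TV_is_lub (f : R -> R) (a b : R) :
  lip1 f -> InI a -> InI b -> a <= b ->
  is_lub (fun s => exists t n, partition a b t n /\ s = variation f t n) (TV f a b).
Proof.
  intros Hf Ha Hb Hab.
  destruct (variation_chord f a b Hab) as (t & n & Hp & _).
  apply (real_Lub_correct _ (variation f t n) (b - a)).
  - now exists t, n.
  - intros s (t' & n' & Hp' & ->). now apply variation_le.
Qed.

Lemma TV_bounds (f : R -> R) (a b : R) :
  lip1 f -> InI a -> InI b -> a <= b -> Rabs (f b - f a) <= TV f a b <= b - a.
Proof.
  intros Hf Ha Hb Hab. destruct (TV_is_lub f a b Hf Ha Hb Hab) as [Hub Hleast]. split.
  - destruct (variation_chord f a b Hab) as (t & n & Hp & <-). apply Hub. now exists t, n.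
  - apply Hleast. intros s (t & n & Hp & ->). now apply variation_le.
Qed.

Lemma TV_superadditive (f : R -> R) (a b c : R) :
  lip1 f -> InI a -> InI b -> InI c -> a <= b -> b <= c ->
  TV f a b + TV f b c <= TV f a c.
Proof.
  intros Hf Ha Hb Hc Hab Hbc.
  destruct (TV_is_lub f a b Hf Ha Hb Hab) as [_ Hab_least].
  destruct (TV_is_lub f b c Hf Hb Hc Hbc) as [_ Hbc_least].
  destruct (TV_is_lub f a c Hf Ha Hc ltac:(lra)) as [Hub _].
  enough (TV f a b <= TV f a c - TV f b c) by lra.
  apply Hab_least; intros s (t & n & Hp & ->).
  enough (TV f b c <= TV f a c - variation f t n) by lra.
  apply Hbc_least; intros s (u & m & Hq & ->).
  enough (variation f t n + variation f u m <= TV f a c) by lra.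
  (* [w] concatenates the two partitions; both formulas agree at index [n], where
     [t n = b = u 0]. *)
  apply Hub. set (w := fun i => if le_lt_dec i n then t i else u (i - n)%nat).
  destruct Hp as (Hp0 & Hpn & Hpm), Hq as (Hq0 & Hqn & Hqm).
  assert (Hwl : forall i, (i <= n)%nat -> w i = t i).
  { intros i Hi; unfold w; destruct (le_lt_dec i n); [reflexivity | lia]. }
  assert (Hwr : forall i, w (n + i)%nat = u i).
  { intros i; unfold w; destruct (le_lt_dec (n + i) n).
    - replace i with 0%nat by lia. rewrite Nat.add_0_r, Hpn, Hq0; reflexivity.
    - f_equal; lia. }
  exists w, (n + m)%nat. split.
  - repeat split.
    + rewrite Hwl by lia; assumption.
    + rewrite Hwr; assumption.
    + intros i Hi. destruct (le_lt_dec n i).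
      * replace i with (n + (i - n))%nat by lia. rewrite <- Nat.add_succ_r, !Hwr.
        apply Hqm; lia.
      * rewrite !Hwl by lia. apply Hpm; lia.
  - unfold variation. rewrite psum_cat. f_equal; apply psum_ext; intros i Hi.
    + rewrite !Hwl by lia; reflexivity.
    + rewrite <- Nat.add_succ_r, !Hwr; reflexivity.
Qed.

(* Truncating a partition of [a, c] above and below b gives partitions of [a, b] and [b, c]. *)
Lemma TV_subadditive (f : R -> R) (a b c : R) :
  lip1 f -> InI a -> InI b -> InI c -> a <= b -> b <= c ->
  TV f a c <= TV f a b + TV f b c.
Proof.
  intros Hf Ha Hb Hc Hab Hbc.
  destruct (TV_is_lub f a b Hf Ha Hb Hab) as [Hab_ub _].
  destruct (TV_is_lub f b c Hf Hb Hc Hbc) as [Hbc_ub _].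
  destruct (TV_is_lub f a c Hf Ha Hc ltac:(lra)) as [_ Hleast].
  apply Hleast; intros s (t & n & (H0 & Hn & Hm) & ->).
  assert (Hlow : variation f (fun i => Rmin (t i) b) n <= TV f a b).
  { apply Hab_ub. exists (fun i => Rmin (t i) b), n. split; [| reflexivity].
    repeat split.
    - rewrite H0; apply Rmin_left; lra.
    - rewrite Hn; apply Rmin_right; lra.
    - intros i Hi. apply Rle_min_compat_r, Hm, Hi. }
  assert (Hhigh : variation f (fun i => Rmax (t i) b) n <= TV f b c).
  { apply Hbc_ub. exists (fun i => Rmax (t i) b), n. split; [| reflexivity].
    repeat split.
    - rewrite H0; apply Rmax_right; lra.
    - rewrite Hn; apply Rmax_left; lra.
    - intros i Hi. apply Rle_max_compat_r, Hm, Hi. }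
  enough (variation f t n <= variation f (fun i => Rmin (t i) b) n
                             + variation f (fun i => Rmax (t i) b) n) by lra.
  unfold variation. rewrite <- psum_plus. apply psum_le. intros i Hi.
  pose proof (Hm i Hi) as Hle.
  destruct (Rle_or_lt (t (S i)) b) as [Hc1 | Hc1].
  - rewrite !Rmin_left, !Rmax_right by lra.
    replace (f b - f b) with 0 by ring. rewrite Rabs_R0; lra.
  - rewrite (Rmin_right (t (S i))), (Rmax_left (t (S i))) by lra.
    destruct (Rle_or_lt b (t i)) as [Hc2 | Hc2].
    + rewrite Rmin_right, Rmax_left by lra.
      replace (f b - f b) with 0 by ring. rewrite Rabs_R0; lra.
    + rewrite Rmin_left, Rmax_right by lra.
      (* This cell straddles [b] and is cut there. *)
      replace (f (t (S i)) - f (t i)) with ((f b - f (t i)) + (f (t (S i)) - f b)) by ring.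
      apply Rabs_triang.
Qed.

Lemma TV_additive (f : R -> R) (a b c : R) :
  lip1 f -> InI a -> InI b -> InI c -> a <= b -> b <= c ->
  TV f a c = TV f a b + TV f b c.
Proof.
  intros. apply Rle_antisym; [apply TV_subadditive | apply TV_superadditive]; assumption.
Qed.

(** * Exit points of a Lipschitz function from a superlevel set *)

(** [b] is the supremum of the [y] with [f >= v] on [x, y]. Values just left of [b] give [v <= f b],
    and values below [v] arbitrarily close on its right give [f b <= v]. *)
Lemma lip1_exit_right (f : R -> R) (v x : R) :
  lip1 f -> InI x -> v <= f x -> f 1 < v ->
  exists b, x <= b < 1 /\ f b = v /\ (forall t, x <= t <= b -> v <= f t) /\
    (forall z, b < z <= 1 -> exists t, b < t <= z /\ f t < v).
Proof.
  intros Hf Hx Hvx H1. pose proof Hx as [Hx0 Hx1].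
  set (E := fun y => x <= y <= 1 /\ forall t, x <= t <= y -> v <= f t).
  assert (HEx : E x).
  { split; [lra |]. intros t Ht. now replace t with x by lra. }
  destruct (completeness E) as [b Hb].
  { exists 1. intros y [Hy _]; lra. }
  { now exists x. }
  assert (Hxb : x <= b) by now apply Hb.
  assert (Hb1 : b <= 1) by (apply Hb; intros y [Hy _]; lra).
  assert (HIb : InI b) by (unfold InI; lra).
  assert (Hbelow : forall t, x <= t < b -> v <= f t).
  { intros t Ht. destruct (is_lub_approx E b t Hb ltac:(lra)) as (y & [_ Hy] & Hty).
    apply Hy; lra. }
  assert (Hvb : v <= f b).
  { apply le_of_forall_eps; intros eps Heps.
    destruct (Rle_lt_or_eq_dec x b Hxb) as [Hlt | <-]; [| lra].
    pose proof (Rmax_l x (b - eps)). pose proof (Rmax_r x (b - eps)).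
    pose proof (Rmax_lub_lt x (b - eps) b ltac:(lra) ltac:(lra)).
    set (t := Rmax x (b - eps)) in *.
    pose proof (Hbelow t ltac:(lra)).
    pose proof (lip1_bounds f t b Hf ltac:(unfold InI; lra) HIb ltac:(lra)). lra. }
  assert (Hb1' : b < 1).
  { destruct (Rle_lt_or_eq_dec b 1 Hb1) as [| ->]; [assumption | lra]. }
  assert (Hall : forall t, x <= t <= b -> v <= f t).
  { intros t Ht. destruct (Rle_lt_or_eq_dec t b) as [| ->]; [lra | apply Hbelow; lra | exact Hvb]. }
  assert (Hexit : forall z, b < z <= 1 -> exists t, b < t <= z /\ f t < v).
  { intros z Hz. apply NNPP; intro Hno.
    enough (z <= b) by lra. apply Hb. split; [lra |]. intros t Ht.
    destruct (Rle_or_lt t b); [apply Hall; lra |].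
    destruct (Rle_or_lt v (f t)); [assumption |].
    exfalso; apply Hno. exists t; split; lra. }
  exists b. repeat split; try assumption.
  apply Rle_antisym; [| assumption].
  apply le_of_forall_eps; intros eps Heps.
  pose proof (Rmin_l (b + eps) 1). pose proof (Rmin_r (b + eps) 1).
  pose proof (Rmin_glb_lt (b + eps) 1 b ltac:(lra) ltac:(lra)).
  destruct (Hexit (Rmin (b + eps) 1) ltac:(lra)) as (t & Ht & Hft).
  pose proof (lip1_bounds f b t Hf HIb ltac:(unfold InI in *; lra) ltac:(lra)). lra.
Qed.

(** Reflect by [t -> 1 - t]. *)
Lemma lip1_exit_left (f : R -> R) (v x : R) :
  lip1 f -> InI x -> v <= f x -> f 0 < v ->
  exists a, 0 < a <= x /\ f a = v /\ (forall t, a <= t <= x -> v <= f t).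
Proof.
  intros Hf Hx Hvx H0.
  destruct (lip1_exit_right (fun t => f (1 - t)) v (1 - x)) as (b & Hb & Hfb & Hall & _).
  - intros s t Hs Ht Hst. rewrite Rabs_minus_sym.
    replace (t - s) with ((1 - s) - (1 - t)) by ring.
    apply Hf; unfold InI in *; lra.
  - unfold InI in *; lra.
  - now replace (1 - (1 - x)) with x by ring.
  - now replace (1 - 1) with 0 by ring.
  - exists (1 - b). repeat split; try lra.
    intros t Ht. replace t with (1 - (1 - t)) by ring. apply Hall; lra.
Qed.

(** * A copula from a pair of nondecreasing 1-Lipschitz functions *)

Section Envelopes.

Variables p q : R -> R.
Hypothesis p_lip : mono_lip1 p.
Hypothesis q_lip : mono_lip1 q.
Hypothesis p_le_q : forall x, InI x -> p x <= q x.
Hypothesis pq0 : p 0 = q 0.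
Hypothesis pq1 : p 1 = q 1.

(** For the envelopes of a diagonal section this is [dhat delta]. *)
Let gap (x : R) : R := q x - p x.

Lemma gap_lip : lip1 gap.
Proof.
  intros x y Hx Hy Hxy. unfold gap. apply Rabs_le.
  pose proof (p_lip x y Hx Hy Hxy). pose proof (q_lip x y Hx Hy Hxy). lra.
Qed.

Lemma gap_nonneg (x : R) : InI x -> 0 <= gap x.
Proof. intros Hx. unfold gap. pose proof (p_le_q x Hx). lra. Qed.

Definition min_gap (x y : R) : R :=
  real (Glb_Rbar (fun v => exists t, x <= t <= y /\ v = gap t)).

Lemma min_gap_is_glb (x y : R) :
  InI x -> InI y -> x <= y ->
  is_glb (fun v => exists t, x <= t <= y /\ v = gap t) (min_gap x y).
Proof.
  intros Hx Hy Hxy. apply (real_Glb_correct _ (gap x) 0).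
  - exists x; split; [lra | reflexivity].
  - intros v (t & Ht & ->). apply gap_nonneg. unfold InI in *; lra.
Qed.

Lemma min_gap_le (x y t : R) :
  InI x -> InI y -> x <= t <= y -> min_gap x y <= gap t.
Proof.
  intros Hx Hy Ht. apply (min_gap_is_glb x y Hx Hy ltac:(lra)). now exists t.
Qed.

Lemma min_gap_ge (x y b : R) :
  InI x -> InI y -> x <= y -> (forall t, x <= t <= y -> b <= gap t) -> b <= min_gap x y.
Proof.
  intros Hx Hy Hxy Hb. apply (min_gap_is_glb x y Hx Hy Hxy).
  intros v (t & Ht & ->). now apply Hb.
Qed.

Lemma min_gap_to_zero (x y t : R) :
  InI x -> InI y -> x <= t <= y -> gap t = 0 -> min_gap x y = 0.
Proof.
  intros Hx Hy Ht Ht0. apply Rle_antisym.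
  - rewrite <- Ht0. now apply min_gap_le.
  - apply min_gap_ge; [assumption | assumption | lra |].
    intros s Hs. apply gap_nonneg. unfold InI in *; lra.
Qed.

(* Above the diagonal, the largest value compatible with the diagonal section; below it,
   the Bertino copula, which is the smallest. *)
Definition extremal_copula (x y : R) : R :=
  if Rle_dec x y then x + Rmin 0 (p y - q x) else y - min_gap y x.

Lemma extremal_above (x y : R) : x <= y -> extremal_copula x y = x + Rmin 0 (p y - q x).
Proof. intros H. unfold extremal_copula. destruct (Rle_dec x y); [reflexivity | contradiction]. Qed.

Lemma extremal_diag (x : R) : InI x -> extremal_copula x x = x - gap x.
Proof.
  intros Hx. rewrite extremal_above by lra. unfold gap.
  rewrite Rmin_right; [ring | pose proof (p_le_q x Hx); lra].
Qed.

Lemma extremal_below (x y : R) :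
  InI x -> InI y -> y <= x -> extremal_copula x y = y - min_gap y x.
Proof.
  intros Hx Hy Hyx. destruct (Req_dec x y) as [-> | Hne].
  - rewrite extremal_diag by assumption. f_equal.
    apply Rle_antisym; [apply min_gap_ge | apply min_gap_le]; try assumption; try lra.
    intros t Ht. replace t with y by lra. lra.
  - unfold extremal_copula. destruct (Rle_dec x y); [lra | reflexivity].
Qed.

Definition rect_volume (C : R -> R -> R) (a b c e : R) : R :=
  C b e + C a c - C b c - C a e.

(** The linear terms cancel. What remains is the concave function [Rmin 0] summed at the inner
    points [p e - q b], [p c - q a], minus its sum at the outer points [p c - q b], [p e - q a];
    both pairs of points have the same sum. *)
Lemma extremal_volume_above (a b c e : R) :
  InI a -> InI b -> InI c -> InI e -> a <= b -> b <= c -> c <= e ->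
  0 <= rect_volume extremal_copula a b c e.
Proof.
  intros Ha Hb Hc He Hab Hbc Hce. unfold rect_volume.
  rewrite !extremal_above by lra.
  pose proof (q_lip a b Ha Hb Hab). pose proof (p_lip c e Hc He Hce).
  unfold Rmin; repeat destruct (Rle_dec _ _); lra.
Qed.

(** [c, b] is the union of [c, a] and [e, b], and [e, a] is their intersection. The minimum over the
    union is the smaller of the two minima, and the minimum over the intersection is at least the
    larger one. *)
Lemma extremal_volume_below (a b c e : R) :
  InI a -> InI b -> InI c -> InI e -> a <= b -> c <= e -> e <= a ->
  0 <= rect_volume extremal_copula a b c e.
Proof.
  intros Ha Hb Hc He Hab Hce Hea. unfold rect_volume.
  rewrite !extremal_below by (assumption || lra).
  assert (Hmid1 : min_gap e b <= min_gap e a)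
    by (apply min_gap_ge; try assumption; intros; apply min_gap_le; try assumption; lra).
  assert (Hmid2 : min_gap c a <= min_gap e a)
    by (apply min_gap_ge; try assumption; intros; apply min_gap_le; try assumption; lra).
  assert (Hout : Rmin (min_gap c a) (min_gap e b) <= min_gap c b).
  { apply min_gap_ge; try assumption; try lra. intros t Ht.
    destruct (Rle_or_lt t a).
    - eapply Rle_trans; [apply Rmin_l | apply min_gap_le; try assumption; lra].
    - eapply Rle_trans; [apply Rmin_r | apply min_gap_le; try assumption; lra]. }
  unfold Rmin in Hout; destruct (Rle_dec _ _); lra.
Qed.

Lemma extremal_volume_square (a b : R) :
  InI a -> InI b -> a <= b -> 0 <= rect_volume extremal_copula a b a b.
Proof.
  intros Ha Hb Hab. unfold rect_volume.
  rewrite (extremal_below b a), (extremal_above a b), !extremal_diag by (assumption || lra).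
  pose proof (Rmin_r 0 (p b - q a)) as Hmin.
  (* The left side is [q b - p a - (b - a)]. Between [a] and [t] the function [p] gains at most
     [t - a], and between [t] and [b] the function [q] gains at most [b - t]. *)
  assert (Hm : gap a - (b - q b) + (a - q a) <= min_gap a b).
  { apply min_gap_ge; try assumption. intros t Ht.
    assert (HIt : InI t) by (unfold InI in *; lra).
    pose proof (p_lip a t Ha HIt ltac:(lra)). pose proof (q_lip t b HIt Hb ltac:(lra)).
    unfold gap. lra. }
  unfold gap in *. lra.
Qed.

(* Cut along the lines x, y = max a c and x, y = min b e. *)
Lemma extremal_volume_nonneg (a b c e : R) :
  InI a -> InI b -> InI c -> InI e -> a <= b -> c <= e ->
  0 <= rect_volume extremal_copula a b c e.
Proof.
  intros Ha Hb Hc He Hab Hce.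
  destruct (Rle_or_lt b c); [now apply extremal_volume_above |].
  destruct (Rle_or_lt e a); [now apply extremal_volume_below |].
  assert (Hlo : exists lo, InI lo /\ a <= lo /\ c <= lo /\ (lo = a \/ lo = c)).
  { destruct (Rle_or_lt a c); [exists c | exists a]; repeat split; auto; try lra;
      apply Ha || apply Hc. }
  destruct Hlo as (lo & Hlo & Halo & Hclo & Hlo_or).
  assert (Hhi : exists hi, InI hi /\ hi <= b /\ hi <= e /\ (hi = b \/ hi = e)).
  { destruct (Rle_or_lt b e); [exists b | exists e]; repeat split; auto; try lra;
      apply Hb || apply He. }
  destruct Hhi as (hi & Hhi & Hbhi & Hehi & Hhi_or).
  assert (Hlohi : lo <= hi) by (destruct Hlo_or, Hhi_or; subst; lra).
  pose proof (extremal_volume_above a lo lo hi Ha Hlo Hlo Hhi Halo (Rle_refl _) Hlohi).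
  pose proof (extremal_volume_above a lo hi e Ha Hlo Hhi He Halo Hlohi Hehi).
  pose proof (extremal_volume_above lo hi hi e Hlo Hhi Hhi He Hlohi (Rle_refl _) Hehi).
  pose proof (extremal_volume_below lo hi c lo Hlo Hhi Hc Hlo Hlohi Hclo (Rle_refl _)).
  pose proof (extremal_volume_below hi b c lo Hhi Hb Hc Hlo Hbhi Hclo Hlohi).
  pose proof (extremal_volume_below hi b lo hi Hhi Hb Hlo Hhi Hbhi Hlohi (Rle_refl _)).
  pose proof (extremal_volume_square lo hi Hlo Hhi Hlohi).
  (* Two of the nine cells are degenerate, since [lo] is [a] or [c] and [hi] is [b] or [e]. *)
  assert (rect_volume extremal_copula a lo c lo = 0)
    by (unfold rect_volume; destruct Hlo_or; subst; ring).
  assert (rect_volume extremal_copula hi b hi e = 0)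
    by (unfold rect_volume; destruct Hhi_or; subst; ring).
  unfold rect_volume in *. lra.
Qed.

Lemma extremal_boundary (x : R) :
  InI x -> extremal_copula x 0 = 0 /\ extremal_copula 0 x = 0 /\
           extremal_copula x 1 = x /\ extremal_copula 1 x = x.
Proof.
  intros Hx. pose proof Hx as [Hx0 Hx1].
  pose proof (p_lip 0 x InI_0 Hx Hx0). pose proof (q_lip x 1 Hx InI_1 Hx1).
  rewrite (extremal_below x 0), (extremal_above 0 x), (extremal_above x 1),
    (extremal_below 1 x) by (assumption || exact InI_0 || exact InI_1).
  (* [p x - q 0 = p x - p 0] and [p 1 - q x = q 1 - q x] are nonnegative. *)
  rewrite !Rmin_left by lra.
  rewrite (min_gap_to_zero 0 x 0), (min_gap_to_zero x 1 1)
    by (assumption || exact InI_0 || exact InI_1 || (unfold gap; lra)).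
  repeat split; lra.
Qed.

Lemma extremal_is_copula : copula extremal_copula.
Proof.
  split; [| split].
  - intros x y Hx Hy.
    pose proof (extremal_boundary x Hx) as (Bx0 & B0x & Bx1 & _).
    pose proof (extremal_boundary y Hy) as (_ & B0y & _).
    pose proof (extremal_boundary 0 InI_0) as (B00 & _ & B01 & _).
    (* The volumes of [0, x] x [0, y] and [0, x] x [y, 1] give [0 <= C x y <= x]. *)
    pose proof (extremal_volume_nonneg 0 x 0 y InI_0 Hx InI_0 Hy (proj1 Hx) (proj1 Hy)).
    pose proof (extremal_volume_nonneg 0 x y 1 InI_0 Hx Hy InI_1 (proj1 Hx) (proj2 Hy)).
    unfold rect_volume, InI in *. lra.
  - exact extremal_boundary.
  - intros a b c e Ha Hb Hc He Hab Hce.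
    pose proof (extremal_volume_nonneg a b c e Ha Hb Hc He Hab Hce).
    unfold rect_volume in *. lra.
Qed.

(** When [q x <= p y], the value at (x, y) is [x], so the difference equals [min_gap x y]. *)
Lemma extremal_asymmetry (x y : R) :
  InI x -> InI y -> x <= y -> q x <= p y -> (forall t, x <= t <= y -> gap x <= gap t) ->
  gap x <= extremal_copula x y - extremal_copula y x.
Proof.
  intros Hx Hy Hxy Hqp Hmin.
  rewrite (extremal_above x y), (extremal_below y x), Rmin_left by (assumption || lra).
  pose proof (min_gap_ge x y _ Hx Hy Hxy Hmin). lra.
Qed.

(** * The largest level *)

(** These conditions make the asymmetry of [extremal_copula] at (x, y) at least [v]. *)
Definition level (v x y : R) : Prop :=
  InI x /\ InI y /\ x <= y /\ q x <= p y /\ forall t, x <= t <= y -> v <= gap t.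

Lemma gap0 : gap 0 = 0.
Proof. unfold gap. lra. Qed.

Lemma gap1 : gap 1 = 0.
Proof. unfold gap. lra. Qed.

(** Go left and right from [x] to half its height. By monotonicity the midpoint of [p x] and [q x]
    separates [q a] from [p b]. This makes the supremum of the levels positive. *)
Lemma level_of_point (x : R) : InI x -> 0 < gap x -> exists a b, level (gap x / 2) a b.
Proof.
  intros Hx Hpos.
  destruct (lip1_exit_left gap (gap x / 2) x gap_lip Hx ltac:(lra) ltac:(rewrite gap0; lra))
    as (a & Ha & Hga & Halla).
  destruct (lip1_exit_right gap (gap x / 2) x gap_lip Hx ltac:(lra) ltac:(rewrite gap1; lra))
    as (b & Hb & Hgb & Hallb & _).
  assert (HIa : InI a) by (unfold InI in *; lra).
  assert (HIb : InI b) by (unfold InI in *; lra).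
  exists a, b. repeat split; try apply HIa; try apply HIb; try lra.
  - pose proof (p_lip a x HIa Hx ltac:(lra)). pose proof (q_lip x b Hx HIb ltac:(lra)).
    unfold gap in *. lra.
  - intros t Ht. destruct (Rle_or_lt t x); [apply Halla | apply Hallb]; lra.
Qed.

(* If p y < q x, push y to the right until p reaches q x; as gap + p = q is nondecreasing,
   gap loses at most q x - p y on the way. *)
Lemma level_of_deficit (A x y : R) :
  InI x -> InI y -> x <= y ->
  (forall t, x <= t <= y -> A <= gap t + Rmin 0 (p y - q x)) ->
  exists y', level A x y'.
Proof.
  intros Hx Hy Hxy HA.
  assert (HA0 : forall t, x <= t <= y -> A <= gap t)
    by (intros t Ht; pose proof (HA t Ht); pose proof (Rmin_l 0 (p y - q x)); lra).
  destruct (Rle_or_lt (q x) (p y)) as [Hqp | Hqp].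
  { exists y. now repeat split; try apply Hx; try apply Hy. }
  pose proof (HA y ltac:(lra)) as HAy. rewrite Rmin_right in HAy by lra.
  (* [p] climbs to [q x] because [p 1 = q 1 >= q x]; the point is an exit point of [- p]. *)
  assert (Hy' : exists y', y <= y' /\ InI y' /\ p y' = q x).
  { pose proof (q_lip x 1 Hx InI_1 (proj2 Hx)).
    destruct (Req_dec (p 1) (q x)) as [Heq | Hne].
    { exists 1. unfold InI in *; repeat split; lra. }
    destruct (lip1_exit_right (fun t => - p t) (- q x) y) as (b & Hb & Hpb & _).
    - intros s t Hs Ht Hst. pose proof (p_lip s t Hs Ht Hst). apply Rabs_le; lra.
    - exact Hy.
    - lra.
    - lra.
    - exists b. unfold InI in *; repeat split; lra. }
  destruct Hy' as (y' & Hyy' & HIy' & Hpy').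
  exists y'. repeat split; try apply Hx; try apply HIy'; try lra.
  intros t Ht. destruct (Rle_or_lt t y); [apply HA0; lra |].
  assert (HIt : InI t) by (unfold InI in *; lra).
  pose proof (q_lip y t Hy HIt ltac:(lra)). pose proof (p_lip t y' HIt HIy' ltac:(lra)).
  unfold gap in *. lra.
Qed.

Lemma level_bounded (v x y : R) : level v x y -> v <= 1.
Proof.
  intros (Hx & Hy & Hxy & _ & Hv). pose proof (Hv x ltac:(lra)).
  pose proof (lip1_bounds gap 0 x gap_lip InI_0 Hx (proj1 Hx)).
  rewrite gap0 in *. unfold InI in *; lra.
Qed.

Definition is_sup_level (M : R) : Prop := is_lub (fun v => exists x y, level v x y) M.

Lemma sup_level_exists :
  (exists x, InI x /\ 0 < gap x) -> exists M, 0 < M /\ is_sup_level M.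
Proof.
  intros (x & Hx & Hpos). destruct (level_of_point x Hx Hpos) as (a & b & Hab).
  destruct (completeness (fun v => exists x y, level v x y)) as [M HM].
  - exists 1. intros v (s & t & Hst). exact (level_bounded v s t Hst).
  - now exists (gap x / 2), a, b.
  - exists M; split; [| exact HM].
    assert (gap x / 2 <= M) by (apply HM; now exists a, b). lra.
Qed.

Lemma level_weaken (v v' x y : R) : v <= v' -> level v' x y -> level v x y.
Proof.
  intros Hv (Hx & Hy & Hxy & Hqp & Hall). repeat split; try apply Hx; try apply Hy; auto.
  intros t Ht. pose proof (Hall t Ht); lra.
Qed.

(* The left ends of the intervals of level v move to the right as v grows to M, so their
   infimum has a limit. *)
Lemma level_limit_point (M : R) :
  is_sup_level M ->
  exists x, InI x /\ forall eps v, 0 < eps -> v < M ->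
    exists v' s t, v <= v' /\ level v' s t /\ Rabs (s - x) < eps.
Proof.
  intros HM.
  (* The supremum of [W] is the limit of these infima. *)
  set (W := fun w => InI w /\ exists v, v < M /\ forall s t, level v s t -> w <= s).
  destruct (completeness W) as [x Hx].
  { exists 1. intros w [Hw _]; apply Hw. }
  { exists 0. split; [unfold InI; lra |]. exists (M - 1). split; [lra |].
    intros s t (Hs & _); apply Hs. }
  assert (W0 : W 0).
  { split; [unfold InI; lra |]. exists (M - 1). split; [lra |].
    intros s t (Hs & _); apply Hs. }
  assert (HIx : InI x).
  { split; [now apply Hx | apply Hx; intros w [Hw _]; apply Hw]. }
  exists x. split; [exact HIx |]. intros eps v Heps Hv.
  destruct (is_lub_approx W x (x - eps) Hx ltac:(lra)) as (w & [Hw (v1 & Hv1 & Hleft)] & Hxw).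
  set (v' := Rmax v v1).
  assert (Hv'M : v' < M) by (apply Rmax_lub_lt; assumption).
  assert (Hclose : exists s t, level v' s t /\ s < x + eps).
  { destruct (Rle_or_lt (x + eps / 2) 1) as [Hin | Hout].
    (* Otherwise [x + eps / 2] would belong to [W]. *)
    - apply NNPP; intro Hno.
      enough (x + eps / 2 <= x) by lra. apply Hx. split; [unfold InI in *; lra |].
      exists v'. split; [assumption |]. intros s t Hst.
      destruct (Rle_or_lt (x + eps / 2) s); [assumption |].
      exfalso; apply Hno. exists s, t; split; [assumption | lra].
    - destruct (is_lub_approx _ M v' HM Hv'M) as (v2 & (s & t & Hst) & Hv2).
      exists s, t. split; [apply level_weaken with v2; [lra | assumption] |].
      destruct Hst as (Hs & _). unfold InI in *; lra. }
  destruct Hclose as (s & t & Hst & Hs).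
  exists v', s, t. split; [apply Rmax_l |]. split; [assumption |].
  pose proof (Hleft s t (level_weaken v1 v' s t (Rmax_r _ _) Hst)).
  apply Rabs_def1; lra.
Qed.

Lemma gap_ge_at_limit (M x : R) :
  InI x ->
  (forall eps v, 0 < eps -> v < M ->
     exists v' s t, v <= v' /\ level v' s t /\ Rabs (s - x) < eps) ->
  M <= gap x.
Proof.
  intros Hx Hacc. apply le_of_forall_eps; intros eps Heps.
  destruct (Hacc (eps / 2) (M - eps / 2) ltac:(lra) ltac:(lra))
    as (v' & s & t & Hv' & (Hs & _ & Hst & _ & Hall) & Hsx).
  pose proof (Hall s ltac:(lra)). apply Rabs_def2 in Hsx.
  destruct (Rle_or_lt s x).
  - pose proof (lip1_bounds gap s x gap_lip Hs Hx ltac:(lra)). lra.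
  - pose proof (lip1_bounds gap x s gap_lip Hx Hs ltac:(lra)). lra.
Qed.

Definition exits_right (M b : R) : Prop :=
  forall z, b < z <= 1 -> exists t, b < t <= z /\ gap t < M.

(** Let [a, b] be the interval around the limit point [x] on which [gap >= M]. Intervals [s, t] of
    level near [M] with [s] near [x] cannot contain a point [z] just right of [b] with [gap z < M].
    Hence [q s <= p t <= p z], and in the limit [q a <= q x <= p b]. *)
Lemma sup_level_attained (M : R) :
  0 < M -> is_sup_level M ->
  exists a b, level M a b /\ gap a = M /\ gap b = M /\ b < 1 /\ exits_right M b.
Proof.
  intros HMpos HM. destruct (level_limit_point M HM) as (x & Hx & Hacc).
  pose proof (gap_ge_at_limit M x Hx Hacc) as HMx.
  destruct (lip1_exit_left gap M x gap_lip Hx HMx ltac:(rewrite gap0; lra))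
    as (a & Ha & Hga & Halla).
  destruct (lip1_exit_right gap M x gap_lip Hx HMx ltac:(rewrite gap1; lra))
    as (b & Hb & Hgb & Hallb & Hexit).
  assert (HIa : InI a) by (unfold InI in *; lra).
  assert (HIb : InI b) by (unfold InI in *; lra).
  assert (Hqx : q x <= p b).
  { apply le_of_forall_eps; intros eps Heps.
    pose proof (Rmin_l (b + eps / 2) 1). pose proof (Rmin_r (b + eps / 2) 1).
    pose proof (Rmin_glb_lt (b + eps / 2) 1 b ltac:(lra) ltac:(lra)).
    destruct (Hexit (Rmin (b + eps / 2) 1) ltac:(lra)) as (z & Hz & Hgz).
    pose proof (Rmin_l (eps / 2) (z - b)). pose proof (Rmin_r (eps / 2) (z - b)).
    pose proof (Rmin_glb_lt (eps / 2) (z - b) 0 ltac:(lra) ltac:(lra)).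
    (* The radius [z - b] forces [s < z], as [x <= b]; a level strictly between [gap z] and [M] then
       forces [t <= z]. *)
    destruct (Hacc (Rmin (eps / 2) (z - b)) ((gap z + M) / 2) ltac:(lra) ltac:(lra))
      as (v' & s & t & Hv' & (Hs & HIt & Hst & Hqp & Hall) & Hsx).
    apply Rabs_def2 in Hsx.
    assert (HIz : InI z) by (unfold InI in *; lra).
    assert (Htz : t <= z).
    { destruct (Rle_or_lt t z); [assumption |]. pose proof (Hall z ltac:(lra)). lra. }
    pose proof (p_lip t z HIt HIz Htz). pose proof (p_lip b z HIb HIz ltac:(lra)).
    destruct (Rle_or_lt s x).
    - pose proof (q_lip s x Hs Hx ltac:(lra)). lra.
    - pose proof (q_lip x s Hx Hs ltac:(lra)). lra. }
  exists a, b. repeat split; try apply HIa; try apply HIb; try assumption; try lra.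
  - pose proof (q_lip a x HIa Hx ltac:(lra)). lra.
  - intros t Ht. destruct (Rle_or_lt t x); [apply Halla | apply Hallb]; lra.
Qed.

(** The conditions on the left end are closed, so their supremum satisfies them. The last clause
    later forces the gap above [M] just right of [a]. *)
Lemma sup_level_rightmost (M : R) :
  0 < M -> is_sup_level M ->
  exists a b, level M a b /\ gap a = M /\ gap b = M /\ b < 1 /\ exits_right M b /\
    forall x, a <= x <= b -> gap x = M -> q x <= p b -> x <= a.
Proof.
  intros HMpos HM.
  destruct (sup_level_attained M HMpos HM)
    as (a0 & b & (Ha0 & Hb & Hab & Hqp & Hall) & Hga0 & Hgb & Hb1 & Hexit).
  set (X := fun x => a0 <= x <= b /\ gap x = M /\ q x <= p b).
  assert (HX0 : X a0) by (repeat split; lra || assumption).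
  destruct (completeness X) as [a Ha].
  { exists b. intros x [Hx _]; lra. }
  { now exists a0. }
  assert (Ha0a : a0 <= a) by now apply Ha.
  assert (Hale : a <= b) by (apply Ha; intros x [Hx _]; lra).
  assert (HIa : InI a) by (unfold InI in *; lra).
  assert (Hnear : forall eps, 0 < eps -> gap a <= M + eps /\ q a <= p b + eps).
  { intros eps Heps.
    destruct (is_lub_approx X a (a - eps) Ha ltac:(lra)) as (x & HXx & Hax).
    assert (Hxa : x <= a) by now apply Ha.
    destruct HXx as (Hx & Hgx & Hqx).
    assert (HIx : InI x) by (unfold InI in *; lra).
    pose proof (lip1_bounds gap x a gap_lip HIx HIa Hxa).
    pose proof (q_lip x a HIx HIa Hxa). lra. }
  assert (Hga : gap a = M).
  { apply Rle_antisym; [| apply Hall; lra].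
    apply le_of_forall_eps; intros eps Heps; now apply Hnear. }
  assert (Hqa : q a <= p b) by (apply le_of_forall_eps; intros eps Heps; now apply Hnear).
  exists a, b. repeat split; try apply HIa; try apply Hb; try assumption.
  - intros t Ht; apply Hall; lra.
  - intros x Hx Hgx Hqx. apply Ha. repeat split; lra || assumption.
Qed.

End Envelopes.

(** * The envelopes of a diagonal section *)

(** For a diagonal section, this is [x] minus the positive variation of [dhat delta] on [0, x];
    [upper_env] subtracts the negative variation instead. *)
Definition lower_env (delta : R -> R) (x : R) : R :=
  x - / 2 * (dhat delta x + TV (dhat delta) 0 x).

Definition upper_env (delta : R -> R) (x : R) : R :=
  x + / 2 * (dhat delta x - TV (dhat delta) 0 x).

(** Reduces the absolute value in the asymmetry to a one-sided bound. *)
Lemma copula_transpose (C : R -> R -> R) : copula C -> copula (fun x y => C y x).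
Proof.
  intros (Hrange & Hbd & Hvol). split; [| split].
  - intros x y Hx Hy; now apply Hrange.
  - intros x Hx. destruct (Hbd x Hx) as (? & ? & ? & ?). now repeat split.
  - intros a b c e Ha Hb Hc He Hab Hce. pose proof (Hvol c e a b Hc He Ha Hb Hce Hab). lra.
Qed.

Section Diagonal.

Variable delta : R -> R.
Hypothesis delta_diag : diagonal_section delta.

Let d : R -> R := dhat delta.
Let p : R -> R := lower_env delta.
Let q : R -> R := upper_env delta.

Lemma dhat_lip : lip1 d.
Proof.
  destruct delta_diag as (_ & _ & Hlip & _). intros x y Hx Hy Hxy.
  pose proof (Hlip x y Hx Hy Hxy). unfold d, dhat. apply Rabs_le; lra.
Qed.

Lemma env_gap (x : R) : q x - p x = d x.
Proof. unfold p, q, d, upper_env, lower_env. field. Qed.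

Lemma env_ge (x : R) : InI x -> p x <= q x.
Proof.
  destruct delta_diag as (_ & Hle & _). intros Hx.
  pose proof (Hle x Hx). pose proof (env_gap x). unfold d, dhat in *. lra.
Qed.

Lemma env_0 : p 0 = q 0.
Proof.
  destruct delta_diag as (Hin & Hle & _).
  pose proof (Hle 0 InI_0). destruct (Hin 0 InI_0).
  pose proof (env_gap 0). unfold d, dhat in *. lra.
Qed.

Lemma env_1 : p 1 = q 1.
Proof.
  destruct delta_diag as (_ & _ & _ & H1).
  pose proof (env_gap 1). unfold d, dhat in *. lra.
Qed.

Lemma TV_from_0 (x y : R) : InI x -> InI y -> x <= y -> TV d 0 y = TV d 0 x + TV d x y.
Proof.
  intros Hx Hy Hxy. apply TV_additive; try assumption.
  - exact dhat_lip.
  - exact InI_0.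
  - apply Hx.
Qed.

(** [TV d x y] lies between the absolute increment of [d] and [y - x], so half its sum with that
    increment lies between 0 and [y - x]. *)
Lemma lower_env_lip : mono_lip1 p.
Proof.
  intros x y Hx Hy Hxy. unfold p, lower_env. fold d. rewrite (TV_from_0 x y) by assumption.
  pose proof (TV_bounds d x y dhat_lip Hx Hy Hxy) as [Hlow Hup].
  pose proof (lip1_bounds d x y dhat_lip Hx Hy Hxy).
  apply Rabs_le_between in Hlow. lra.
Qed.

Lemma upper_env_lip : mono_lip1 q.
Proof.
  intros x y Hx Hy Hxy. unfold q, upper_env. fold d. rewrite (TV_from_0 x y) by assumption.
  pose proof (TV_bounds d x y dhat_lip Hx Hy Hxy) as [Hlow Hup].
  pose proof (lip1_bounds d x y dhat_lip Hx Hy Hxy).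
  apply Rabs_le_between in Hlow. lra.
Qed.

Lemma fdelta_env (x y : R) :
  InI x -> InI y -> x <= y -> fdelta delta x y = x + (p y - q x).
Proof.
  intros Hx Hy Hxy. unfold fdelta, TVs, p, q, lower_env, upper_env. fold d.
  destruct (Rle_dec x y); [| contradiction].
  rewrite (TV_from_0 x y) by assumption. field.
Qed.

Lemma Dfo_env (x y : R) :
  InI x -> InI y -> x <= y -> Dfo delta x y <-> p y < q x.
Proof.
  intros Hx Hy Hxy. unfold Dfo. rewrite fdelta_env, Rmin_left by assumption.
  split; [intros (_ & _ & H); lra |]. intros H; repeat split; try apply Hx; try apply Hy; lra.
Qed.

(** * The functions gU and hdelta *)

Lemma Df_of_Dfo (x y : R) : Dfo delta x y -> Df delta x y.
Proof.
  intros H. left. intros eps Heps. exists x, y. split; [assumption |].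
  rewrite !Rminus_diag, Rabs_R0. now split.
Qed.

Lemma Df_le_1 (x y : R) : Df delta x y -> y <= 1.
Proof.
  intros [Hcl | [Hx ->]]; [| apply Hx].
  apply le_of_forall_eps; intros eps Heps.
  destruct (Hcl eps Heps) as (a & b & (_ & Hb & _) & _ & Hby).
  apply Rabs_def2 in Hby. unfold InI in *; lra.
Qed.

Lemma gU_is_lub (x : R) : InI x -> is_lub (Df delta x) (gU delta x).
Proof.
  intros Hx. apply (real_Lub_correct _ x 1).
  - right; now split.
  - intros y; apply Df_le_1.
Qed.

Lemma gU_ge (x : R) : InI x -> x <= gU delta x.
Proof. intros Hx. apply gU_is_lub; [assumption |]. right; now split. Qed.

Lemma gU_InI (x : R) : InI x -> InI (gU delta x).
Proof.
  intros Hx. split; [pose proof (gU_ge x Hx); unfold InI in *; lra |].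
  apply gU_is_lub; [assumption |]. intros y; apply Df_le_1.
Qed.

(** If [p] were below [q x] at [gU delta x], it would stay below a little further right, which puts
    points of [Df] beyond the supremum. At 1 this is excluded by [p 1 = q 1]. *)
Lemma gU_env (x : R) : InI x -> q x <= p (gU delta x).
Proof.
  intros Hx. pose proof (gU_ge x Hx) as Hxg. pose proof (gU_InI x Hx) as Hg.
  destruct (Rle_or_lt (q x) (p (gU delta x))) as [| Hlt]; [assumption | exfalso].
  pose proof (upper_env_lip x 1 Hx InI_1 (proj2 Hx)). pose proof env_1.
  destruct (Rle_lt_or_eq_dec _ _ (proj2 Hg)) as [Hg1 | Hg1]; [| rewrite Hg1 in Hlt; lra].
  set (g := gU delta x) in *.
  pose proof (Rmin_l (g + (q x - p g) / 2) 1). pose proof (Rmin_r (g + (q x - p g) / 2) 1).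
  pose proof (Rmin_glb_lt (g + (q x - p g) / 2) 1 g ltac:(lra) Hg1).
  set (y := Rmin (g + (q x - p g) / 2) 1) in *.
  assert (Hy : InI y) by (unfold InI in *; lra).
  pose proof (lower_env_lip g y Hg Hy ltac:(lra)).
  enough (y <= g) by lra.
  apply gU_is_lub; [assumption |]. apply Df_of_Dfo, Dfo_env; try assumption; lra.
Qed.

Lemma gU_gt (x : R) : InI x -> 0 < d x -> x < gU delta x.
Proof.
  intros Hx Hd. pose proof (gU_ge x Hx). pose proof (gU_env x Hx) as Henv.
  pose proof (env_gap x).
  destruct (Req_dec x (gU delta x)) as [Heq | Hne]; [rewrite <- Heq in Henv; lra | lra].
Qed.

Lemma hdelta_is_lub (x : R) :
  InI x ->
  is_lub (fun y => InI y /\ x <= y /\ forall t, x <= t <= y -> d t >= d x) (hdelta delta x).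
Proof.
  intros Hx. apply (real_Lub_correct _ x 1).
  - repeat split; try apply Hx; try lra. intros t Ht. replace t with x by lra. lra.
  - intros y (Hy & _); apply Hy.
Qed.

Lemma hdelta_le (s r : R) : InI s -> s <= r -> d r < d s -> hdelta delta s <= r.
Proof.
  intros Hs Hsr Hd. apply hdelta_is_lub; [assumption |].
  intros y (_ & _ & Hy). destruct (Rle_or_lt y r); [assumption |].
  pose proof (Hy r ltac:(lra)). lra.
Qed.

Lemma hdelta_InI (x : R) : InI x -> InI (hdelta delta x).
Proof.
  intros Hx. split.
  - apply Rle_trans with x; [apply Hx |]. apply hdelta_is_lub; [assumption |].
    repeat split; try apply Hx; try lra. intros t Ht. replace t with x by lra. lra.
  - apply hdelta_is_lub; [assumption |]. intros y (Hy & _); apply Hy.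
Qed.

(** The supremum defining [hdelta] is attained: if [d t < d x], the same holds at some [s] slightly
    left of [t], so [hdelta delta x <= s < t]. *)
Lemma hdelta_spec (x t : R) : InI x -> x <= t <= hdelta delta x -> d x <= d t.
Proof.
  intros Hx Ht. destruct (Rle_or_lt (d x) (d t)) as [| Hlt]; [assumption | exfalso].
  pose proof (hdelta_InI x Hx).
  assert (HIt : InI t) by (unfold InI in *; lra).
  pose proof (hdelta_le x t Hx ltac:(lra) Hlt).
  assert (Hxt : x < t) by (destruct (Req_dec x t) as [-> |]; lra).
  pose proof (Rmax_l x (t - (d x - d t) / 2)). pose proof (Rmax_r x (t - (d x - d t) / 2)).
  pose proof (Rmax_lub_lt x (t - (d x - d t) / 2) t Hxt ltac:(lra)).
  set (s := Rmax x (t - (d x - d t) / 2)) in *.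
  assert (HIs : InI s) by (unfold InI in *; lra).
  pose proof (lip1_bounds d s t dhat_lip HIs HIt ltac:(lra)).
  pose proof (hdelta_le x s Hx ltac:(lra) ltac:(lra)). lra.
Qed.

Lemma liminf_h_le (x y : R) :
  InI x ->
  (forall eps eta, 0 < eps -> 0 < eta ->
     exists s, InI s /\ 0 < Rabs (s - x) < eps /\ hdelta delta s <= y + eta) ->
  liminf_h delta x <= y.
Proof.
  intros Hx Hnear.
  assert (Hbound : forall r, (exists eps, 0 < eps /\
     r = real (Glb_Rbar (fun v => exists t, InI t /\ 0 < Rabs (t - x) < eps
                                        /\ v = hdelta delta t))) -> r <= y).
  { intros r (eps & Heps & ->). apply le_of_forall_eps; intros eta Heta.
    destruct (Hnear eps eta Heps Heta) as (s & Hs & Hsx & Hhs).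
    eapply Rle_trans; [| exact Hhs].
    apply (real_Glb_correct _ (hdelta delta s) 0).
    - now exists s.
    - intros v (t & Ht & _ & ->). now apply hdelta_InI.
    - now exists s. }
  apply (real_Lub_correct _ (real (Glb_Rbar (fun v => exists t, InI t /\
    0 < Rabs (t - x) < 1 /\ v = hdelta delta t))) y); [| exact Hbound | exact Hbound].
  exists 1. split; [lra | reflexivity].
Qed.

(** * Bounds for copulas with a given diagonal *)

Section Copula.

Variable C : R -> R -> R.
Hypothesis C_copula : copula C.
Hypothesis C_diag : forall t, InI t -> C t t = delta t.

Lemma copula_mono_l (x x' y : R) :
  InI x -> InI x' -> InI y -> x <= x' -> C x y <= C x' y.
Proof.
  destruct C_copula as (_ & Hbd & Hvol). intros Hx Hx' Hy Hxx'.
  pose proof (Hvol x x' 0 y Hx Hx' InI_0 Hy Hxx' (proj1 Hy)).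
  destruct (Hbd x Hx) as (? & _). destruct (Hbd x' Hx') as (? & _). lra.
Qed.

Lemma copula_le_l (x y : R) : InI x -> InI y -> C x y <= x.
Proof.
  destruct C_copula as (_ & Hbd & Hvol). intros Hx Hy.
  pose proof (Hvol 0 x y 1 InI_0 Hx Hy InI_1 (proj1 Hx) (proj2 Hy)).
  destruct (Hbd x Hx) as (_ & _ & ? & _). destruct (Hbd y Hy) as (_ & ? & _).
  destruct (Hbd 1 InI_1) as (_ & ? & _). lra.
Qed.

(** [C y x >= C t x], and the volume of [t, 1] x [x, t] bounds [C t x] from below. *)
Lemma copula_below_diag (x t y : R) :
  InI x -> InI t -> InI y -> x <= t <= y -> x - d t <= C y x.
Proof.
  destruct C_copula as (_ & Hbd & Hvol). intros Hx HIt Hy Ht.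
  pose proof (copula_mono_l t y x HIt Hy Hx ltac:(lra)).
  pose proof (Hvol t 1 x t HIt InI_1 Hx HIt (proj2 HIt) ltac:(lra)).
  destruct (Hbd x Hx) as (_ & _ & _ & ?). destruct (Hbd t HIt) as (_ & _ & _ & ?).
  pose proof (C_diag t HIt). unfold d, dhat. lra.
Qed.

(* The mass of [x, 1] x [s, s'] dominates that of [s', 1] x [s, s'], which is at least
   d s' - d s; sum over a partition. *)
Lemma copula_variation (x y : R) (t : nat -> R) (n : nat) :
  InI x -> InI y -> partition x y t n ->
  variation d t n + d x + d y <= 2 * (y - C x y).
Proof.
  destruct C_copula as (_ & Hbd & Hvol). intros Hx Hy Hp.
  assert (Hk : forall k, (k <= n)%nat ->
    variation d t k + d x + d (t k) <= 2 * (t k - C x (t k))).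
  { induction k as [| k IH]; intros Hkn; unfold variation; simpl.
    - destruct Hp as (-> & _). rewrite C_diag by assumption. unfold d, dhat. lra.
    - specialize (IH ltac:(lia)). unfold variation in IH.
      pose proof (partition_in _ _ _ _ k Hp ltac:(lia)) as Hs.
      pose proof (partition_in _ _ _ _ (S k) Hp ltac:(lia)) as Hs'.
      pose proof (partition_le _ _ _ _ k (S k) Hp ltac:(lia) ltac:(lia)) as Hss'.
      set (s := t k) in *. set (s' := t (S k)) in *.
      assert (HIs : InI s) by (unfold InI in *; lra).
      assert (HIs' : InI s') by (unfold InI in *; lra).
      pose proof (Hvol x s' s s' Hx HIs' HIs HIs' ltac:(lra) Hss').
      pose proof (Hvol x 1 s s' Hx InI_1 HIs HIs' (proj2 Hx) Hss').
      pose proof (copula_mono_l s s' s HIs HIs' HIs Hss').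
      destruct (Hbd s HIs) as (_ & _ & _ & ?). destruct (Hbd s' HIs') as (_ & _ & _ & ?).
      pose proof (C_diag s HIs). pose proof (C_diag s' HIs').
      assert (Rabs (d s' - d s) + d s' - d s <= 2 * ((s' - s) - (C x s' - C x s))).
      (* A decrease of [d] uses the volume of [x, 1] x [s, s']; an increase uses that of [x, s'] x
         [s, s'] and [C s s <= C s' s]. *)
      { unfold Rabs; destruct (Rcase_abs _); unfold d, dhat in *; lra. }
      lra. }
  specialize (Hk n (Nat.le_refl n)). destruct Hp as (_ & Hn & _). now rewrite Hn in Hk.
Qed.

Lemma copula_above_diag (x y : R) :
  InI x -> InI y -> x <= y -> C x y <= x + Rmin 0 (p y - q x).
Proof.
  intros Hx Hy Hxy.
  pose proof (copula_le_l x y Hx Hy).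
  assert (TV d x y <= 2 * (y - C x y) - d x - d y).
  { apply (TV_is_lub d x y dhat_lip Hx Hy Hxy). intros s (t & n & Hp & ->).
    pose proof (copula_variation x y t n Hx Hy Hp). lra. }
  pose proof (fdelta_env x y Hx Hy Hxy) as Hf.
  unfold fdelta, TVs in Hf. fold d in Hf.
  destruct (Rle_dec x y); [| contradiction].
  unfold Rmin; destruct (Rle_dec _ _); lra.
Qed.

(** The bounds on both sides of the diagonal give [C x y - C y x <= d t + Rmin 0 (p y - q x)] for
    all [t] in [x, y], so the difference is itself a level. *)
Lemma copula_asymmetry_above (M x y : R) :
  is_sup_level p q M -> InI x -> InI y -> x <= y -> C x y - C y x <= M.
Proof.
  intros HM Hx Hy Hxy. apply HM. exists x.
  apply level_of_deficit with (y := y); try assumption.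
  - exact lower_env_lip.
  - exact upper_env_lip.
  - exact env_1.
  - intros t Ht. rewrite env_gap.
    assert (HIt : InI t) by (unfold InI in *; lra).
    pose proof (copula_above_diag x y Hx Hy Hxy).
    pose proof (copula_below_diag x t y Hx HIt Hy Ht). lra.
Qed.

End Copula.

Lemma copula_asymmetry_le (C : R -> R -> R) (M x y : R) :
  copula C -> (forall t, InI t -> C t t = delta t) -> is_sup_level p q M ->
  InI x -> InI y -> Rabs (C x y - C y x) <= M.
Proof.
  intros HC Hdiag HM Hx Hy.
  pose proof (copula_transpose C HC) as HC'.
  apply Rabs_le. destruct (Rle_or_lt x y).
  - pose proof (copula_asymmetry_above C HC Hdiag M x y HM Hx Hy ltac:(lra)).
    pose proof (copula_asymmetry_above _ HC' Hdiag M x y HM Hx Hy ltac:(lra)). simpl in *; lra.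
  - pose proof (copula_asymmetry_above C HC Hdiag M y x HM Hy Hx ltac:(lra)).
    pose proof (copula_asymmetry_above _ HC' Hdiag M y x HM Hy Hx ltac:(lra)). simpl in *; lra.
Qed.

(** * The maximal asymmetry *)

Lemma mu_le (C : R -> R -> R) (M : R) :
  (forall x y, InI x -> InI y -> Rabs (C x y - C y x) <= M) -> mu C <= M.
Proof.
  intros HM.
  assert (Hb : forall v, (exists x y, InI x /\ InI y /\ v = Rabs (C x y - C y x)) -> v <= M)
    by (intros v (x & y & Hx & Hy & ->); now apply HM).
  apply (real_Lub_correct _ (Rabs (C 0 0 - C 0 0)) M); [| exact Hb | exact Hb].
  exists 0, 0. split; [exact InI_0 | split; [exact InI_0 | reflexivity]].
Qed.

Lemma mu_ge (C : R -> R -> R) (x y : R) :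
  copula C -> InI x -> InI y -> C x y - C y x <= mu C.
Proof.
  intros (Hrange & _) Hx Hy.
  eapply Rle_trans; [apply Rle_abs |].
  apply (real_Lub_correct _ (Rabs (C x y - C y x)) 1).
  - now exists x, y.
  - intros v (s & t & Hs & Ht & ->).
    destruct (Hrange s t Hs Ht). destruct (Hrange t s Ht Hs). apply Rabs_le; lra.
  - now exists x, y.
Qed.

Definition witness : R -> R -> R := extremal_copula p q.

Lemma witness_copula : copula witness.
Proof.
  apply extremal_is_copula; [exact lower_env_lip | exact upper_env_lip | exact env_ge
    | exact env_0 | exact env_1].
Qed.

Lemma witness_diag (t : R) : InI t -> witness t t = delta t.
Proof.
  intros Ht. unfold witness. rewrite extremal_diag by (exact env_ge || assumption).
  rewrite env_gap. unfold d, dhat. ring.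
Qed.

Lemma mu_delta_is_lub (M : R) :
  is_sup_level p q M ->
  is_lub (fun v => exists C, copula C /\ (forall t, InI t -> C t t = delta t) /\ v = mu C)
    (mu_delta delta).
Proof.
  intros HM. apply (real_Lub_correct _ (mu witness) M).
  - exists witness. split; [exact witness_copula | split; [exact witness_diag | reflexivity]].
  - intros v (C & HC & Hdiag & ->). apply mu_le.
    intros x y Hx Hy. now apply copula_asymmetry_le.
Qed.

Lemma mu_delta_le (M : R) : is_sup_level p q M -> mu_delta delta <= M.
Proof.
  intros HM. apply (mu_delta_is_lub M HM).
  intros v (C & HC & Hdiag & ->). apply mu_le.
  intros x y Hx Hy. now apply copula_asymmetry_le.
Qed.

Lemma Hdelta_le_h (x y : R) : Hdelta delta x y -> y <= hdelta delta x.
Proof. intros [_ [-> | (_ & _ & H)]]; lra. Qed.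

(** [gU delta x <= hdelta delta x] keeps [d >= d x] on [x, gU delta x], and [q x <= p (gU delta x)];
    so [witness] has asymmetry at least [d x] at (x, gU delta x). *)
Lemma dhat_le_mu_delta (M x : R) :
  is_sup_level p q M -> InI x -> Hdelta delta x (gU delta x) -> d x <= mu_delta delta.
Proof.
  intros HM Hx HH. apply Hdelta_le_h in HH.
  pose proof (gU_InI x Hx) as Hg. pose proof (gU_ge x Hx) as Hxg.
  apply Rle_trans with (mu witness).
  - apply Rle_trans with (witness x (gU delta x) - witness (gU delta x) x);
      [| now apply mu_ge; [exact witness_copula | |]].
    rewrite <- env_gap. apply extremal_asymmetry; try assumption.
    + exact env_ge.
    + now apply gU_env.
    + intros t Ht. rewrite !env_gap. apply hdelta_spec; [assumption | lra].
  - apply (mu_delta_is_lub M HM).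
    exists witness. split; [exact witness_copula | split; [exact witness_diag | reflexivity]].
Qed.

(** * The left end of an optimal interval gives a point of [Hdelta] *)

Section Maximizer.

Variables M a b : R.
Hypothesis M_pos : 0 < M.
Hypothesis M_sup : is_sup_level p q M.
Hypothesis ab_level : level p q M a b.
Hypothesis gap_a : d a = M.
Hypothesis gap_b : d b = M.
Hypothesis b_lt_1 : b < 1.
Hypothesis b_exits : exits_right p q M b.
Hypothesis a_rightmost : forall x, a <= x <= b -> d x = M -> q x <= p b -> x <= a.

(** Right of [b] the gap drops below [M] while [q] does not decrease, so [p] rises strictly above
    [p b >= q a]. This keeps [Dfo] away from (a, y) for every [y > b]. *)
Lemma gU_le_b : gU delta a <= b.
Proof.
  destruct ab_level as (Ha & Hb & Hab & Hqp & _).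
  apply gU_is_lub; [assumption |]. intros y Hy.
  pose proof (Df_le_1 a y Hy) as Hy1.
  destruct (Rle_or_lt y b) as [| Hby]; [assumption | exfalso].
  destruct Hy as [Hcl | [_ ->]]; [| lra].
  set (b' := (b + y) / 2).
  destruct (b_exits b' ltac:(unfold b'; lra)) as (t & Ht & Hgt). rewrite env_gap in Hgt.
  assert (HIt : InI t) by (unfold b', InI in *; lra).
  pose proof (upper_env_lip b t Hb HIt ltac:(lra)).
  pose proof (env_gap b). pose proof (env_gap t).
  assert (Hpt : p b < p t) by lra.
  pose proof (Rmin_l (p t - p b) ((y - b) / 2)). pose proof (Rmin_r (p t - p b) ((y - b) / 2)).
  pose proof (Rmin_glb_lt (p t - p b) ((y - b) / 2) 0 ltac:(lra) ltac:(lra)).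
  (* The first bound keeps [q s] at most [p t], the second keeps [u] to the right of [t]. *)
  set (eps := Rmin (p t - p b) ((y - b) / 2)) in *.
  destruct (Hcl eps ltac:(lra)) as (s & u & HD & Hsa & Huy).
  apply Rabs_def2 in Hsa. apply Rabs_def2 in Huy.
  pose proof HD as (Hs & Hu & _).
  apply Dfo_env in HD; try assumption; [| unfold b' in *; lra].
  pose proof (lower_env_lip t u HIt Hu ltac:(unfold b' in *; lra)).
  destruct (Rle_or_lt s a).
  - pose proof (upper_env_lip s a Hs Ha ltac:(lra)). lra.
  - pose proof (upper_env_lip a s Ha Hs ltac:(lra)). lra.
Qed.

Lemma hdelta_eq_b : hdelta delta a = b.
Proof.
  destruct ab_level as (Ha & Hb & Hab & _ & Hall).
  destruct (hdelta_is_lub a Ha) as [Hub Hleast]. apply Rle_antisym.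
  - apply Hleast. intros y (Hy & _ & Hdy).
    destruct (Rle_or_lt y b) as [| Hby]; [assumption | exfalso].
    destruct (b_exits y ltac:(unfold InI in *; lra)) as (t & Ht & Hgt).
    rewrite env_gap in Hgt. pose proof (Hdy t ltac:(lra)). lra.
  - apply Hub. repeat split; try apply Hb; try assumption.
    intros t Ht. pose proof (Hall t Ht) as Hgt. rewrite env_gap in Hgt. lra.
Qed.

(* Just to the right of a the gap exceeds M by the choice of a, but by maximality of M it
   cannot stay that large up to any z > gU a. *)
Lemma hdelta_near_a (eps eta : R) :
  gU delta a < b -> 0 < eps -> 0 < eta ->
  exists s, InI s /\ 0 < Rabs (s - a) < eps /\ hdelta delta s <= gU delta a + eta.
Proof.
  intros Hgb Heps Heta.
  destruct ab_level as (Ha & Hb & Hab & Hqp & Hall).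
  assert (Hag : a < gU delta a) by (apply gU_gt; [assumption | lra]).
  set (g := gU delta a) in *.
  assert (Hz : exists z, g < z < b /\ z <= g + eta).
  { exists (g + Rmin eta ((b - g) / 2)).
    pose proof (Rmin_l eta ((b - g) / 2)). pose proof (Rmin_r eta ((b - g) / 2)).
    pose proof (Rmin_glb_lt eta ((b - g) / 2) 0 ltac:(lra) ltac:(lra)). lra. }
  destruct Hz as (z & Hgz & Hzeta).
  assert (HIz : InI z) by (unfold InI in *; lra).
  (* Without such an [e], the point (a, z) would lie in [Df] although [z > gU delta a]. *)
  assert (He : exists e, 0 < e /\ forall s, a < s < a + e -> s <= z -> q s <= p z).
  { apply NNPP; intro Hno. enough (z <= g) by lra.
    apply gU_is_lub; [assumption |]. left. intros e He.
    apply NNPP; intro Hno'. apply Hno. exists e. split; [assumption |].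
    intros s Hs Hsz. destruct (Rle_or_lt (q s) (p z)) as [| Hlt]; [assumption | exfalso].
    apply Hno'. exists s, z. split; [apply Dfo_env; try assumption; unfold InI in *; lra |].
    rewrite Rminus_diag, Rabs_R0. split; [apply Rabs_def1; lra | assumption]. }
  destruct He as (e & Hepos & He).
  assert (Hs : exists s, a < s < a + e /\ s < a + eps /\ s <= z).
  { exists (a + Rmin (Rmin e eps) (z - a) / 2).
    pose proof (Rmin_l e eps). pose proof (Rmin_r e eps).
    pose proof (Rmin_glb_lt e eps 0 Hepos Heps).
    pose proof (Rmin_l (Rmin e eps) (z - a)). pose proof (Rmin_r (Rmin e eps) (z - a)).
    pose proof (Rmin_glb_lt (Rmin e eps) (z - a) 0 ltac:(lra) ltac:(lra)). lra. }
  destruct Hs as (s & Hse & Hseps & Hsz).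
  assert (HIs : InI s) by (unfold InI in *; lra).
  pose proof (He s Hse Hsz) as Hqs.
  assert (HMs : M < d s).
  { pose proof (Hall s ltac:(lra)) as HMs. rewrite env_gap in HMs.
    destruct (Rle_lt_or_eq_dec _ _ HMs) as [| Heq]; [assumption | exfalso].
    pose proof (lower_env_lip z b HIz Hb ltac:(lra)).
    pose proof (a_rightmost s ltac:(lra) (eq_sym Heq) ltac:(lra)). lra. }
  (* Otherwise [s, z] would have level [d s > M]. *)
  assert (Hr : exists r, s <= r <= z /\ d r < d s).
  { apply NNPP; intro Hno. enough (d s <= M) by lra.
    apply M_sup. exists s, z. repeat split; try apply HIs; try apply HIz; try assumption.
    intros t Ht. rewrite env_gap. destruct (Rle_or_lt (d s) (d t)); [assumption |].
    exfalso; apply Hno. now exists t. }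
  destruct Hr as (r & Hr & Hdr).
  exists s. split; [assumption |]. split.
  - rewrite Rabs_right by lra. lra.
  - pose proof (hdelta_le s r HIs ltac:(lra) Hdr). lra.
Qed.

Lemma Hdelta_at_a : Hdelta delta a (gU delta a).
Proof.
  pose proof ab_level as (Ha & _). split; [assumption |].
  destruct (Rle_lt_or_eq_dec _ _ gU_le_b) as [Hlt | Heq];
    [right | left; now rewrite hdelta_eq_b].
  split; [| split].
  - split; [assumption |]. intros Hcont.
    (* Continuity would keep [hdelta] above the midpoint of [gU delta a] and [b] near [a], yet it
       takes values at most that midpoint there. *)
    destruct (Hcont ((b - gU delta a) / 2) ltac:(lra)) as (e & He & Hclose).
    destruct (hdelta_near_a e ((b - gU delta a) / 2) Hlt He ltac:(lra))
      as (s & Hs & Hsa & Hh).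
    pose proof (Hclose s Hs ltac:(lra)) as Habs.
    rewrite hdelta_eq_b in Habs. apply Rabs_def2 in Habs. lra.
  - apply liminf_h_le; [assumption |]. intros eps eta. now apply hdelta_near_a.
  - rewrite hdelta_eq_b. lra.
Qed.

End Maximizer.

End Diagonal.

(** * The maximal asymmetry as a maximum over points of [Hdelta] *)

Theorem theorem4p8 (delta : R -> R) :
  diagonal_section delta ->
  (exists x, InI x /\ delta x <> x) ->
  is_max (fun v => exists x, InI x /\ Hdelta delta x (gU delta x) /\
                              gU delta x > x /\ v = dhat delta x)
         (mu_delta delta).
Proof.
  intros Hdiag (x0 & Hx0 & Hne).
  pose proof (lower_env_lip delta Hdiag) as Hp. pose proof (upper_env_lip delta Hdiag) as Hq.
  pose proof (env_0 delta Hdiag) as H0. pose proof (env_1 delta Hdiag) as H1.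
  destruct (sup_level_exists (lower_env delta) (upper_env delta) Hp Hq H0 H1)
    as (M & HMpos & HM).
  { exists x0. split; [assumption |]. rewrite env_gap.
    destruct Hdiag as (_ & Hle & _). pose proof (Hle x0 Hx0). unfold dhat. lra. }
  destruct (sup_level_rightmost _ _ Hp Hq H0 H1 M HMpos HM)
    as (a & b & Hab & Hga & Hgb & Hb1 & Hexit & Hright).
  rewrite env_gap in Hga, Hgb.
  assert (Hright' : forall x, a <= x <= b -> dhat delta x = M ->
                      upper_env delta x <= lower_env delta b -> x <= a)
    by (intros x Hx Hdx; apply Hright; [assumption | now rewrite env_gap]).
  assert (Ha : InI a) by apply Hab.
  assert (HH : Hdelta delta a (gU delta a)) by (apply (Hdelta_at_a delta Hdiag M a b); assumption).
  split.
  - exists a. repeat split; try apply Ha; try apply HH.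
    + apply gU_gt; [assumption | assumption | lra].
    (* Both sides equal [M]: every copula with this diagonal has asymmetry at most [M], and
       [witness] reaches [dhat delta a = M]. *)
    + apply Rle_antisym.
      * rewrite Hga. now apply mu_delta_le.
      * now apply (dhat_le_mu_delta delta Hdiag M).
  - intros v (x & Hx & HHx & _ & ->). now apply (dhat_le_mu_delta delta Hdiag M).
Qed.
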